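(* For every complex number $q$ with $|q|<1$, $$\sum_{n=0}^{\infty} \sigma\mathrm{Mex}(n)\,q^{n} = \frac{1}{(q;q)_{\infty}} \sum_{k=0}^{\infty} k \, 2^{k-1} q^{\binom{k}{2}} (-q^{k+1};q)_{\infty} \, (1 - q^k).$$
   Context: An overpartition of a non-negative integer $n$ is a partition of $n$ (a finite non-increasing sequence of positive integers with sum $n$) in which the first occurrence of each distinct part may or may not be overlined; the empty overpartition is the only overpartition of $0$. Let $\bar{P}(n)$ be the set of all overpartitions of $n$. For $\lambda\in\bar P(n)$, $\mathrm{Mex}(\lambda)$ is the smallest positive integer that does not occur as a part of $\lambda$, whether overlined or non-overlined (so $\mathrm{Mex}$ of the empty overpartition is $1$). Define $\sigma\mathrm{Mex}(n)=\sum_{\lambda\in\bar P(n)}\mathrm{Mex}(\lambda)$. For complex $a,q$ with $|q|<1$, $(a;q)_\infty=\prod_{k=0}^{\infty}(1-aq^k)$. Here $\binom{k}{2}=k(k-1)/2$ and $q^0=1$. *)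

(* Defs.v *)
From HB Require Import structures.
From mathcomp Require Import all_boot all_order all_algebra.
From mathcomp Require Export complex.
From mathcomp Require Import all_classical all_reals all_analysis.

Set Implicit Arguments.
Unset Strict Implicit.
Unset Printing Implicit Defensive.

Import Order.TTheory GRing.Theory Num.Theory.
Import numFieldNormedType.Exports.

Local Open Scope classical_set_scope.
Local Open Scope ring_scope.

(* An overpartition is the sequence of its parts in order, each paired with a
   flag telling whether that occurrence is overlined. *)
Definition parts (l : seq (nat * bool)) : seq nat := [seq x.1 | x <- l].

(* The last conjunct: an occurrence may be overlined only if the same part
   does not occur earlier in the sequence. *)
Definition is_overpartition (n : nat) (l : seq (nat * bool)) : bool :=
  [&& sorted geq (parts l),
      all (fun m => 0 < m)%N (parts l),
      sumn (parts l) == n &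
      [forall i : 'I_(size l),
        (nth (0%N, false) l i).2 ==>
          ((nth (0%N, false) l i).1 \notin take i (parts l))]].

Definition overpartitions (n : nat) : set (seq (nat * bool)) :=
  [set l | is_overpartition n l].

Lemma mex_exists (l : seq (nat * bool)) :
  exists m, (0 < m)%N && (m \notin parts l).
Proof.
exists (sumn (parts l)).+1 => /=.
apply/negP => /(nthP 0%N)[i il e].
have : (nth 0 (parts l) i <= sumn (parts l))%N.
  elim: (parts l) i il {e} => //= x s IH [|i] /= il; first exact: leq_addr.
  exact: leq_trans (IH i il) (leq_addl _ _).
by rewrite e ltnn.
Qed.

Definition Mex (l : seq (nat * bool)) : nat := ex_minn (mex_exists l).

(* [\sum_(l \in A) _] is 0 by convention on infinite supports, hence the
   next lemma. *)
Lemma finite_overpartitions (n : nat) : finite_set (overpartitions n).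
Proof.
pose T := (n.-bseq ('I_n.+1 * bool))%type.
pose f (t : T) : seq (nat * bool) := [seq (val x.1, x.2) | x <- t].
apply: (@sub_finite_set _ _ (f @` [set: T])); last first.
  by apply: finite_image; exact: finite_finset.
move=> l /and4P[_ lpos /eqP lsum _].
have szl : (size l <= n)%N.
  rewrite -lsum; elim: l lpos {lsum} => //= x l IH /andP[x0 /IH sl].
  exact: (leq_add x0 sl).
have bnd x : x \in l -> (x.1 < n.+1)%N.
  rewrite ltnS -lsum; elim: l {lpos lsum szl} => //= y l IH.
  rewrite inE => /orP[/eqP->|/IH xl]; first exact: leq_addr.
  exact: leq_trans xl (leq_addl _ _).
have szt : (size [seq (inord x.1 : 'I_n.+1, x.2) | x <- l] <= n)%N.
  by rewrite size_map.
exists (Bseq szt) => //=; rewrite /f /= -map_comp -[RHS]map_id.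
by apply/eq_in_map => x /bnd xn /=; rewrite inordK //; case: x xn.
Qed.

Definition sigma_Mex (n : nat) : nat := \sum_(l \in overpartitions n) Mex l.

(* The library equips every [numFieldType] with the topology of its norm, but
   finds it only on a term of that structure, not on the bare type [R[i]]. *)
Definition Cplx (R : realType) : numFieldType := R[i].

(* [limn] has an arbitrary value on a divergent sequence; the partial products
   converge whenever [`|q| < 1]. *)
Definition qpochhammer (R : realType) (a q : Cplx R) : Cplx R :=
  limn (fun n : nat => \prod_(0 <= k < n) (1 - a * q ^+ k)).

(* Main.v *)
Require Import Defs.
From mathcomp Require Import all_boot all_order all_algebra.
From mathcomp Require Import finmap ring.
From mathcomp Require Import all_classical all_reals all_analysis.

Import Order.TTheory GRing.Theory Num.Theory.
Import numFieldNormedType.Exports.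

(* An overpartition with Mex equal to k has every part j < k (weight
   2 q^j / (1 - q^j)), no part k, and any multiplicity of each part j > k
   (weight (1 + q^j) / (1 - q^j)).  Restrict to overpartitions with parts at
   most N, multiplicities at most M and Mex at most N: their generating
   polynomial satisfies a recursion in N, obtained by adding the block of parts
   N+1, which passes to the limit M -> oo and gives a closed form G_N(q).  That
   polynomial agrees with \sum sigmaMex(n) q^n below degree N and has
   coefficients at most sigmaMex(n) beyond, so at |q| it first bounds the
   partial sums of \sum sigmaMex(n) |q|^n, and then G_N(q) differs from the
   N-th partial sum at q by at most the tail of that series.  Finally the
   partial sum over k <= N on the right-hand side is exactly
   (q;q)_N (-q^(N+1);q)_oo G_N(q), so it converges along with G_N(q). *)

Set Implicit Arguments.
Unset Strict Implicit.
Unset Printing Implicit Defensive.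

(** * Overpartitions with bounded parts and multiplicities *)

Definition weight (l : seq (nat * bool)) : nat := sumn (parts l).

Lemma parts_cat l1 l2 : parts (l1 ++ l2) = parts l1 ++ parts l2.
Proof. exact: map_cat. Qed.

Lemma weight_cat l1 l2 : weight (l1 ++ l2) = weight l1 + weight l2.
Proof. by rewrite /weight parts_cat sumn_cat. Qed.

Lemma mem_parts_weight m l : m \in parts l -> m <= weight l.
Proof.
rewrite /weight; elim: (parts l) => //= x s IH.
rewrite inE => /orP[/eqP->|/IH ms]; first exact: leq_addr.
exact: leq_trans ms (leq_addl _ _).
Qed.

Definition part_before (x y : nat * bool) : bool :=
  (y.1 <= x.1) && (y.2 ==> (x.1 != y.1)).

(** The pairwise form is the one that splits over [++], as the block-by-block inductions below
    require. *)
Lemma is_overpartitionE n l : is_overpartition n l =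
  [&& pairwise part_before l, all (fun m => 0 < m) (parts l) & weight l == n].
Proof.
have -> : pairwise part_before l = sorted geq (parts l) &&
    pairwise (fun x y : nat * bool => y.2 ==> (x.1 != y.1)) l.
  rewrite sorted_pairwise; last by move=> x y z xy yz; exact: leq_trans yz xy.
  rewrite pairwise_map -pairwise_relI; exact: eq_pairwise.
rewrite /is_overpartition -/(weight l) -!andbA.
case: (sorted geq _) => //=; rewrite [RHS]andbC -andbA; congr [&& _, _ & _].
apply/forallP/(pairwiseP (0, false)) => [h i j _ jl ij|h i].
  apply/implyP => fj; have /= := h (Ordinal jl); rewrite fj /=; apply: contraNN.
  move=> /eqP <-; have il := ltn_trans ij jl.
  rewrite -(nth_map _ 0 fst) // -/(parts l) -(nth_take 0 ij) mem_nth //.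
  by rewrite size_take size_map (jl : (j < size l) = true).
apply/implyP => fi; apply/negP => /(nthP 0)[j].
rewrite size_take size_map ltn_ord => ji; rewrite nth_take //.
rewrite (nth_map (0, false)); last exact: ltn_trans ji (ltn_ord i).
have := h j i (ltn_trans ji (ltn_ord i)) (ltn_ord i) ji.
by rewrite fi /= => /eqP.
Qed.

(** Runs of 1 to [M] copies of [j]; only the first copy may be overlined, hence the single flag
    [e]. *)
Definition ne_blocks (j M : nat) : seq (seq (nat * bool)) :=
  [seq (j, e) :: nseq m (j, false) | m <- iota 0 M, e <- [:: true; false]].

Definition blocks (j M : nat) : seq (seq (nat * bool)) := [::] :: ne_blocks j M.

Fixpoint box (N M : nat) : seq (seq (nat * bool)) :=
  if N is N'.+1 then [seq b ++ l | b <- blocks N'.+1 M, l <- box N' M]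
  else [:: [::]].

Lemma boxSE N M :
  box N.+1 M = [seq b ++ l | b <- blocks N.+1 M, l <- box N M].
Proof. by []. Qed.

Lemma blocksP j M b :
  reflect (b = [::] \/ exists m e, m < M /\ b = (j, e) :: nseq m (j, false))
    (b \in blocks j M).
Proof.
rewrite inE; apply: (iffP orP) => [[/eqP|]|[->|[m [e [mM ->]]]]].
- by left.
- case/allpairsP => -[m e] /= [+ _ ->]; rewrite mem_iota => /andP[_ mM].
  by right; exists m, e.
- by left.
- right; apply/allpairsP; exists (m, e) => /=; split => //; last by case: e.
  by rewrite mem_iota.
Qed.

Lemma mem_parts_block j M b m : b \in blocks j M -> m \in parts b -> m = j.
Proof.
case/blocksP => [->//|[k [e [_ ->]]]].
by rewrite /parts /= map_nseq inE => /orP[/eqP //|/nseqP[]].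
Qed.

Lemma mem_parts_box N M l m : l \in box N M -> m \in parts l -> 0 < m <= N.
Proof.
elim: N l => [|N IH] l; first by rewrite inE => /eqP ->.
rewrite boxSE => /allpairsP[[b l']] /= [bB /IH{}IH ->]; rewrite parts_cat mem_cat.
by case/orP => [/(mem_parts_block bB) ->|/IH /andP[-> /leqW]] //; rewrite ltnSn.
Qed.

Lemma box_pairwise N M l : l \in box N M -> pairwise part_before l.
Proof.
elim: N l => [|N IH] l; first by rewrite inE => /eqP ->.
rewrite boxSE => /allpairsP[[b l']] /= [bB lB ->]; rewrite pairwise_cat (IH _ lB) andbT.
apply/andP; split.
  apply/allrelP => x y xb yl; rewrite /part_before.
  rewrite (mem_parts_block bB (map_f fst xb)).
  have /andP[_ yN] := mem_parts_box lB (map_f fst yl).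
  by rewrite leqW //= gtn_eqF ?implybT.
case/blocksP: bB => [->//|[m [e [_ ->]]]] /=.
have h k : all (part_before (N.+1, k)) (nseq m (N.+1, false)).
  by rewrite all_nseq /part_before /= leqnn orbT.
rewrite h /=; elim: m h => //= m IHm h.
by have /andP[_ hm] := h false; rewrite hm IHm // => k; have /andP[] := h k.
Qed.

Lemma box_overpartition N M l : l \in box N M -> is_overpartition (weight l) l.
Proof.
move=> lB; rewrite is_overpartitionE eqxx andbT (box_pairwise lB) /=.
by apply/allP => m /(mem_parts_box lB)/andP[].
Qed.

(** Parts being positive, the weight bounds every multiplicity, so [weight l <= M] suffices. The
    copies of the largest admissible part are peeled off by induction on [N]. *)
Lemma mem_box N M l : is_overpartition (weight l) l -> all (geq N) (parts l) ->
  weight l <= M -> l \in box N M.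
Proof.
rewrite is_overpartitionE => /and3P[pl l0 _].
elim: N l pl l0 => [|N IH] l pl l0 lN lM.
  case: l l0 lN {pl lM} => //= x l /andP[x0 _] /andP[+ _].
  by rewrite leqNgt x0.
set p := fun x : nat * bool => x.1 == N.+1.
(* Parts are non-increasing and at most [N.+1], so the copies of [N.+1] form a prefix. *)
have lE : l = seq.filter p l ++ seq.filter (predC p) l.
  elim: l pl lN {l0 lM} => //= x l IHl /andP[xl pl] /andP[xN lN].
  have lE := IHl pl lN; case: (boolP (p x)) => /= px; first by rewrite {1}lE.
  suff p0 : seq.filter p l = [::] by rewrite {1}lE p0.
  apply/eqP; rewrite -size_eq0 size_filter -leqn0 leqNgt -has_count.
  apply/hasPn => y yl; apply/eqP => yN; have /andP[+ _] := allP xl _ yl.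
  by rewrite leqNgt yN; rewrite /p in px; rewrite ltn_neqAle px xN.
rewrite lE boxSE; apply/allpairsP; exists (seq.filter p l, seq.filter (predC p) l) => /=.
split => //; last first.
  apply: IH.
  - by move: pl; rewrite {1}lE pairwise_cat => /and3P[].
  - by move: l0; rewrite {1}lE parts_cat all_cat => /andP[].
  - rewrite /parts all_map; apply/allP => x; rewrite mem_filter => /andP[/= px xl].
    by have := allP lN _ (map_f fst xl); rewrite /= leq_eqVlt -/(p x) (negPf px).
  - by move: lM; rewrite {1}lE weight_cat; apply: leq_trans; rewrite leq_addl.
have : pairwise part_before (seq.filter p l).
  by move: pl; rewrite {1}lE pairwise_cat => /and3P[].
have : weight (seq.filter p l) <= M.
  by move: lM; rewrite {1}lE weight_cat; apply: leq_trans; rewrite leq_addr.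
have : all p (seq.filter p l) by exact: filter_all.
case: (seq.filter p l) => [_ _ _|[j e] s /= /andP[/eqP /= -> sN]]; first exact: mem_head.
rewrite /weight /= => sM /andP[sb _]; apply/blocksP; right; exists (size s), e.
(* These entries repeat the part of the head, so none of them can be overlined. *)
have sE : s = nseq (size s) (N.+1, false).
  apply/all_pred1P/allP => -[k f] ks; have /eqP /= kN := allP sN _ ks.
  by have := allP sb _ ks; rewrite /part_before /= kN eqxx leqnn /= implybF => /negPf ->.
split; last by rewrite -sE.
apply: leq_trans sM; rewrite sE /parts map_nseq sumn_nseq size_nseq /=.
by rewrite addSn ltnS mulSn; apply: leq_trans (leq_addl _ _); rewrite leq_addr.
Qed.

(** The decomposition [b ++ l] is unique: filtering by whether the part is [N.+1] recovers both
    pieces. *)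
Lemma uniq_box N M : uniq (box N M).
Proof.
elim: N => // N IH; rewrite boxSE.
have uB : uniq (blocks N.+1 M).
  rewrite /blocks cons_uniq; apply/andP; split.
    by apply/negP => /allpairsP[[m e] []].
  apply: allpairs_uniq; rewrite ?iota_uniq //.
  move=> [m e] [m' e'] _ _ /= [-> /(congr1 size)].
  by rewrite !size_nseq => ->.
apply: allpairs_uniq => // -[b l] [b' l'].
move=> /allpairsP[[b1 l1] [bB lB [-> ->]]] /allpairsP[[b2 l2] [bB' lB' [-> ->]]] e.
suff H b0 l0 : b0 \in blocks N.+1 M -> l0 \in box N M ->
    seq.filter (fun x => x.1 == N.+1) (b0 ++ l0) = b0 /\
    seq.filter (fun x => x.1 != N.+1) (b0 ++ l0) = l0.
  have {}e : b1 ++ l1 = b2 ++ l2 := e.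
  have [] := H b1 l1 bB lB; have [] := H b2 l2 bB' lB'.
  by rewrite e => -> -> /= -> ->.
move=> bB0 lB0; rewrite !filter_cat.
have hb x : x \in b0 -> x.1 = N.+1.
  by move=> /(map_f fst)/(mem_parts_block bB0).
have hl x : x \in l0 -> (x.1 == N.+1) = false.
  move=> /(map_f fst)/(mem_parts_box lB0)/andP[_ xN].
  by rewrite ltn_eqF.
have nil_filter (p : pred (nat * bool)) s :
    (forall x, x \in s -> p x = false) -> seq.filter p s = [::].
  by move=> ps; apply/eqP; rewrite -[_ == _]negbK -has_filter;
     apply/hasPn => x /ps ->.
split.
  rewrite (nil_filter _ l0) // cats0.
  by apply/all_filterP/allP => x /hb ->.
rewrite (nil_filter _ b0) ?cat0s => [|x /hb ->]; last by rewrite eqxx.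
by apply/all_filterP/allP => x /hl ->.
Qed.

(** * Elementary properties of the Mex *)

Lemma MexP l : [/\ 0 < Mex l, Mex l \notin parts l &
  forall m, 0 < m -> m \notin parts l -> Mex l <= m].
Proof.
rewrite /Mex; case: ex_minnP => m /andP[m0 ml] h; split => // k k0 kl.
by apply: h; rewrite k0.
Qed.

Lemma eq_Mex m l : 0 < m -> m \notin parts l ->
  (forall k, 0 < k < m -> k \in parts l) -> Mex l = m.
Proof.
move=> m0 ml h; have [M0 Ml Mmin] := MexP l; apply/eqP.
rewrite eqn_leq Mmin //= leqNgt; apply: contraNN Ml => lm.
by apply: h; rewrite M0.
Qed.

Lemma lt_Mex k l : 0 < k < Mex l -> k \in parts l.
Proof.
move=> /andP[k0 kM]; have [_ _ Mmin] := MexP l.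
by apply: contraTT kM => kl; rewrite -leqNgt Mmin.
Qed.

Lemma Mex_le_weight l : Mex l <= (weight l).+1.
Proof.
have [_ _ Mmin] := MexP l; apply: Mmin => //; apply/negP.
by move/mem_parts_weight; rewrite ltnn.
Qed.

Lemma Mex_box N M l : l \in box N M -> Mex l <= N.+1.
Proof.
move=> lB; have [_ _ Mmin] := MexP l; apply: Mmin => //; apply/negP.
by move=> /(mem_parts_box lB); rewrite ltnn andbF.
Qed.

(** The list [l] already has 1, ..., [j.-1]; the nonempty block supplies [j], and [j.+1] stays
    absent. *)
Lemma Mex_cat_block_full j M b l : b \in blocks j M -> b != [::] ->
  Mex l = j -> j.+1 \notin parts l -> Mex (b ++ l) = j.+1.
Proof.
move=> bB b0 lj jl; apply: eq_Mex => //.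
  rewrite parts_cat mem_cat negb_or jl andbT.
  by apply/negP => /(mem_parts_block bB) /eqP; rewrite eqn_leq ltnn.
move=> k /andP[k0]; rewrite ltnS leq_eqVlt parts_cat mem_cat => /orP[/eqP ->|kj].
  case: b bB b0 => // x b bB _; apply/orP; left.
  by rewrite -(mem_parts_block bB (mem_head x.1 (parts b))) mem_head.
by apply/orP; right; apply: lt_Mex; rewrite lj k0.
Qed.

Lemma Mex_cat_block j M b l : b \in blocks j M -> Mex l < j -> Mex (b ++ l) = Mex l.
Proof.
move=> bB lj; have [M0 Ml _] := MexP l; apply: eq_Mex => //.
  rewrite parts_cat mem_cat negb_or Ml andbT.
  by apply/negP => /(mem_parts_block bB) e; rewrite e ltnn in lj.
by move=> k /lt_Mex kl; rewrite parts_cat mem_cat kl orbT.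
Qed.

(** * Recursion in the bound on the parts *)

Section GeneratingFunction.
Variable F : comNzRingType.
Local Open Scope ring_scope.
Implicit Type x : F.

(** Only lists whose Mex is final are counted: a Mex of at most [N] survives the addition of parts
    beyond [N], whereas the value [N.+1] may still grow. *)
Definition box_mex_sum (N M : nat) x : F :=
  \sum_(l <- box N M | (Mex l <= N)%N) (Mex l)%:R * x ^+ weight l.

(* Mex > N on the box means that all of 1, ..., N occur. *)
Definition box_full_sum (N M : nat) x : F :=
  \sum_(l <- box N M | ~~ (Mex l <= N)%N) x ^+ weight l.

(** Truncation of [2 x^j / (1 - x^j)]; the factor 2 is the choice of overlining the first copy. *)
Definition block_sum (j M : nat) x : F := 2 * \sum_(0 <= m < M) (x ^+ j) ^+ m.+1.

(** The two summands correspond to an empty and to a nonempty block of [N.+1]. *)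
Lemma sum_boxS N M (P : pred (seq (nat * bool))) (f : seq (nat * bool) -> F) :
  \sum_(l <- box N.+1 M | P l) f l =
  \sum_(l <- box N M | P l) f l +
  \sum_(b <- ne_blocks N.+1 M) \sum_(l <- box N M | P (b ++ l)) f (b ++ l).
Proof.
rewrite boxSE big_mkcond big_allpairs_dep big_cons; congr (_ + _).
  by rewrite -big_mkcond.
by apply: eq_bigr => b _; rewrite -big_mkcond.
Qed.

Lemma sum_ne_blocks j M x :
  \sum_(b <- ne_blocks j M) x ^+ weight b = block_sum j M x.
Proof.
rewrite /ne_blocks big_allpairs_dep /block_sum mulr_sumr /index_iota subn0.
apply: eq_bigr => m _.
rewrite !big_cons big_nil /= addr0 /weight /parts /= map_nseq sumn_nseq /=.
by rewrite -exprM mulnS -mulr2n mulr_natl.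
Qed.

Lemma ne_blocks_sub j M b : b \in ne_blocks j M -> b \in blocks j M /\ b != [::].
Proof.
move=> bB; split; first by rewrite inE bB orbT.
by case/allpairsP: bB => -[m e] [_ _ ->].
Qed.

Lemma box_full_sumS N M x :
  box_full_sum N.+1 M x = box_full_sum N M x * block_sum N.+1 M x.
Proof.
(* With an empty block the Mex is at most [N.+1], so the first summand vanishes. *)
rewrite /box_full_sum sum_boxS big_seq_cond big1 ?add0r => [|l /andP[lB]]; last first.
  by rewrite (Mex_box lB).
rewrite mulrC -sum_ne_blocks mulr_suml big_seq_cond [RHS]big_seq_cond.
apply: eq_bigr => b /andP[/ne_blocks_sub[bB b0] _].
rewrite mulr_sumr big_seq_cond [RHS]big_seq_cond.
apply: eq_big => [l|l _]; last by rewrite weight_cat exprD.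
case lB: (l \in box N M) => //=; congr (~~ _).
case: (leqP (Mex l) N) => Nl; first by rewrite (Mex_cat_block bB) ?ltnS // (leqW Nl).
rewrite (Mex_cat_block_full bB) ?ltnn //.
  by apply/eqP; rewrite eqn_leq (Mex_box lB).
by apply/negP => /(mem_parts_box lB)/andP[_]; rewrite ltnNge leqnSn.
Qed.

(** A Mex of at most [N] is unchanged by any block of [N.+1]. A list with Mex [N.+1] starts to count
    if the block is empty, and moves to Mex [N.+2], which is excluded, if it is not. *)
Lemma box_mex_sumS N M x : box_mex_sum N.+1 M x =
  box_mex_sum N M x * (1 + block_sum N.+1 M x) + N.+1%:R * box_full_sum N M x.
Proof.
have not_full l : l \in box N M -> ~~ (Mex l <= N)%N -> Mex l = N.+1.
  by move=> lB; rewrite -ltnNge => Nl; apply/eqP; rewrite eqn_leq (Mex_box lB).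
rewrite /box_mex_sum sum_boxS mulrDr mulr1 [RHS]addrAC; congr (_ + _).
  rewrite big_seq_cond (bigID (fun l => Mex l <= N)%N) /=; congr (_ + _).
    rewrite [RHS]big_seq_cond; apply: eq_bigl => l.
    case: (Mex l <= N)%N / (boolP (Mex l <= N)%N) => Nl; last by rewrite !andbF.
    by rewrite leqW // !andbT.
  rewrite /box_full_sum mulr_sumr [RHS]big_seq_cond.
  apply: eq_big => [l|l /andP[/andP[lB _] Nl]]; last by rewrite (not_full l).
  by case lB: (l \in box N M) => //=; rewrite (Mex_box lB).
rewrite mulrC -sum_ne_blocks mulr_suml big_seq_cond [RHS]big_seq_cond.
apply: eq_bigr => b /andP[/ne_blocks_sub[bB b0] _].
rewrite mulr_sumr big_seq_cond [RHS]big_seq_cond.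
have M1 l : l \in box N M -> ~~ (Mex l <= N)%N -> Mex (b ++ l) = N.+2.
  move=> lB Nl; apply: (Mex_cat_block_full bB b0 (not_full l lB Nl)).
  by apply/negP => /(mem_parts_box lB)/andP[_]; rewrite ltnNge leqnSn.
have M2 l : (Mex l <= N)%N -> Mex (b ++ l) = Mex l.
  by move=> Nl; rewrite (Mex_cat_block bB) // ltnS.
have M3 l : l \in box N M -> (Mex (b ++ l) <= N.+1)%N = (Mex l <= N)%N.
  move=> lB; case: (boolP (Mex l <= N)%N) => Nl; first by rewrite M2 // leqW.
  by rewrite M1 // ltnn.
apply: eq_big => [l|l /andP[lB]].
  by case lB: (l \in box N M) => //=; rewrite M3.
by rewrite M3 // => Nl; rewrite M2 // weight_cat exprD mulrCA.
Qed.

End GeneratingFunction.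

(** * Coefficients of the bounded generating polynomials *)

Definition box_mex_coef (N M n : nat) : nat :=
  \sum_(l <- box N M | (Mex l <= N)%N && (weight l == n)) Mex l.

(** A duplicate-free list replaces the finitely supported sum, to be compared with [box] by
    inclusion or permutation. *)
Lemma sigma_MexE n : exists s, [/\ uniq s,
  forall l, (l \in s) = is_overpartition n l & sigma_Mex n = \sum_(l <- s) Mex l].
Proof.
have fO := finite_overpartitions n.
exists (enum_fset (fset_set (overpartitions n))); split.
- exact: fset_uniq.
- by move=> l; apply: etrans (in_fset_set fO l) _; apply/idP/idP; rewrite inE.
- by rewrite /sigma_Mex fsbig_finite.
Qed.

Lemma box_mex_coef_overpartition N M n l :
  l \in [seq l <- box N M | (Mex l <= N)%N && (weight l == n)] -> is_overpartition n l.
Proof. by rewrite mem_filter => /andP[/andP[_ /eqP <-] /box_overpartition]. Qed.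

Lemma box_mex_coef_le N M n : box_mex_coef N M n <= sigma_Mex n.
Proof.
have [s [us sE ->]] := sigma_MexE n; rewrite /box_mex_coef -big_filter.
apply: (uniq_sub_le_big leqnn (fun m n => leq_addr n m)) => //.
  by rewrite filter_uniq ?uniq_box.
by move=> l; rewrite sE; exact: box_mex_coef_overpartition.
Qed.

(** From [n < N], both the parts and the Mex, which is at most [n.+1], are at most [N]; [n <= M]
    takes care of the multiplicities. *)
Lemma box_mex_coefE N M n : n < N -> n <= M -> box_mex_coef N M n = sigma_Mex n.
Proof.
move=> nN nM; have [s [us sE ->]] := sigma_MexE n; rewrite /box_mex_coef -big_filter.
apply: perm_big; apply: uniq_perm; rewrite ?filter_uniq ?uniq_box //.
move=> l; rewrite sE; apply/idP/idP; first exact: box_mex_coef_overpartition.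
move=> lO; have lw : weight l = n.
  by move: lO; rewrite is_overpartitionE => /and3P[_ _ /eqP].
rewrite mem_filter lw eqxx andbT (leq_trans (Mex_le_weight l)) ?lw //=.
apply: mem_box; rewrite ?lw //.
apply/allP => m /mem_parts_weight; rewrite lw => mn.
exact: leq_trans mn (ltnW nN).
Qed.

Local Open Scope classical_set_scope.
Local Open Scope ring_scope.

(** * Absolutely convergent complex series and products *)

Section ComplexSeries.
Local Open Scope complex_scope.

Lemma norm_real_complex (R : realType) (a : R) : `|a%:C : Cplx R| = `|a|%:C.
Proof. by rewrite normc_def /= expr0n /= addr0 sqrtr_sqr. Qed.

Lemma normc_le_abs (R : realType) (a b : R) :
  `|(a +i* b : Cplx R)| <= (`|a| + `|b|)%:C.
Proof.
rewrite (complexE (a +i* b)) /=; apply: (le_trans (ler_normD _ _)).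
rewrite normrM !norm_real_complex normc_def /= expr0n expr1n /= add0r sqrtr1.
by rewrite mul1r rmorphD.
Qed.

Lemma cvg_Complex (R : realType) (u v : nat -> R) (a b : R) :
  u @ \oo --> a -> v @ \oo --> b ->
  (fun n => (u n +i* v n : Cplx R)) @ \oo --> (a +i* b : Cplx R).
Proof.
move=> ua vb; apply/cvgrPdist_lt => e e0.
(* In the order on [Cplx R], [0 < e] forces [e] to be real. *)
have [e1 ee1] : exists e1 : R, e = e1%:C.
  by exists (complex.Re e); rewrite RRe_real // gtr0_real.
subst e; have e1_gt0 : 0 < e1 by move: e0; rewrite ltcR.
have e2 : 0 < e1 / 2 by rewrite divr_gt0.
near=> n.
have -> : (a +i* b : Cplx R) - (u n +i* v n) = ((a - u n) +i* (b - v n) : Cplx R).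
  by [].
apply: (le_lt_trans (normc_le_abs _ _)); rewrite ltcR (splitr e1) ltrD //.
- by near: n; move/cvgrPdist_lt : ua; apply.
- by near: n; move/cvgrPdist_lt : vb; apply.
Unshelve. all: by end_near. Qed.


Lemma abs_Re_le (R : realType) (x : Cplx R) : `|complex.Re x| <= complex.Re `|x|.
Proof. by have := normc_ge_Re x; rewrite lecE => /andP[]. Qed.

(** Multiplication by ['i] preserves the norm and moves the imaginary part, up to sign, to the real
    part. *)
Lemma abs_Im_le (R : realType) (x : Cplx R) : `|complex.Im x| <= complex.Re `|x|.
Proof.
have := abs_Re_le (x * 'i%C : Cplx R).
rewrite ReiNIm.
rewrite normrN.
rewrite normrM.
have -> : `|'i%C| = 1 :> Cplx R.
  by rewrite normc_def /= expr0n expr1n /= add0r sqrtr1.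
by rewrite mulr1.
Qed.

Lemma bounded_norm_cvg_series (R : realType) (u : nat -> R) (M : R) :
  (forall n, \sum_(0 <= k < n) `|u k| <= M) -> cvgn (series u).
Proof.
move=> uM; apply: normed_cvg; apply: nondecreasing_is_cvgn.
  by apply: nondecreasing_series => n _ _; exact: normr_ge0.
by exists M => _ [n _ <-]; exact: uM.
Qed.

(** Completeness is used on the reals: the real and imaginary parts form absolutely convergent
    series. *)
Lemma bounded_norm_cvg_seriesC (R : realType) (u : nat -> Cplx R) (M : Cplx R) :
  (forall n, \sum_(0 <= k < n) `|u k| <= M) -> cvgn (series u).
Proof.
move=> uM.
have ReM n : \sum_(0 <= k < n) complex.Re `|u k| <= complex.Re M.
  have := uM n; rewrite lecE => /andP[_]; congr (_ <= _).
  by rewrite (raddf_sum (@complex.Re R : {additive R[i] -> R})).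
have hRe : cvgn (series (fun k => complex.Re (u k))).
  apply: (@bounded_norm_cvg_series _ _ (complex.Re M)) => n.
  by apply: le_trans (ReM n); apply: ler_sum => k _; exact: abs_Re_le.
have hIm : cvgn (series (fun k => complex.Im (u k))).
  apply: (@bounded_norm_cvg_series _ _ (complex.Re M)) => n.
  by apply: le_trans (ReM n); apply: ler_sum => k _; exact: abs_Im_le.
suff -> : series u = (fun n => series (fun k => complex.Re (u k)) n +i*
    series (fun k => complex.Im (u k)) n : Cplx R).
  by apply/cvg_ex; eexists; exact: cvg_Complex hRe hIm.
apply/funext => n; rewrite /series /=.
elim/big_ind3 : _ => // [x1 x2 x3 y1 y2 y3 -> ->|k _] //.
by case: (u k).
Qed.

Lemma prod_le_expR (R : realType) (b : nat -> R) n : (forall k, 0 <= b k) ->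
  \prod_(0 <= k < n) (1 + b k) <= expR (\sum_(0 <= k < n) b k).
Proof.
move=> b0; rewrite expR_sum; apply: ler_prod => k _.
by rewrite addr_ge0 //= expR_ge1Dx.
Qed.

Lemma prod_norm_bounded (R : realType) (a : nat -> Cplx R) (B : Cplx R) :
  (forall n, \sum_(0 <= k < n) `|a k| <= B) ->
  exists C : Cplx R, forall n, \prod_(0 <= k < n) (1 + `|a k|) <= C.
Proof.
move=> aB; exists (expR (complex.Re B))%:C => n.
have ReE k : `|a k| = (complex.Re `|a k|)%:C by rewrite RRe_real.
rewrite (eq_bigr (fun k => (1 + complex.Re `|a k|)%:C)); last first.
  by move=> k _; rewrite rmorphD rmorph1 /= -ReE.
rewrite -rmorph_prod lecR; apply: le_trans (prod_le_expR _ _) _.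
  by move=> k; rewrite -lecR -ReE; exact: normr_ge0.
rewrite ler_expR -lecR rmorph_sum /=.
(* [B] dominates the empty sum, so it is a nonnegative real. *)
have B_real : B \is Num.real by rewrite ger0_real // (le_trans _ (aB 0%N)) // big_geq.
by rewrite (RRe_real B_real); under eq_bigr do rewrite -ReE.
Qed.

End ComplexSeries.

(** * Infinite products *)

Section Products.
Variable R : realType.

(** The partial products [p] are 1 plus the partial sums of [p k * a k]; as [p] is bounded, that
    series converges absolutely. *)
Lemma cvg_prod (a : nat -> Cplx R) (B : Cplx R) :
  (forall n, \sum_(0 <= k < n) `|a k| <= B) ->
  cvgn (fun n => \prod_(0 <= k < n) (1 + a k) : Cplx R).
Proof.
move=> aB; have [C pC] := prod_norm_bounded aB.
set p := fun n => _.
have pE : p = (fun n => 1 + series (fun k => p k * a k) n).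
  apply/funext; elim=> [|n IH]; first by rewrite /p /series /= !big_geq // addr0.
  by rewrite seriesSr addrA -IH {1}/p big_nat_recr //= mulrDr mulr1.
have hp n : `|p n| <= C.
  apply: le_trans (pC n); rewrite normr_prod; apply: ler_prod => k _.
  by rewrite normr_ge0 /= (le_trans (ler_normD _ _)) // normr1.
rewrite pE; apply: is_cvgD; first exact: is_cvg_cst.
apply: (@bounded_norm_cvg_seriesC _ _ (C * B)) => n.
apply: (@le_trans _ _ (C * \sum_(0 <= k < n) `|a k|)).
  by rewrite mulr_sumr; apply: ler_sum => k _; rewrite normrM ler_wpM2r.
by rewrite ler_wpM2l // (le_trans _ (hp 0%N)).
Qed.

(** The reciprocal factors are [1 - a k / (1 + a k)], with [1 + a k] bounded away from 0 by [rho].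
    Their product therefore converges too, and the two limits multiply to 1. *)
Lemma lim_prod_neq0 (a : nat -> Cplx R) (B rho : Cplx R) :
  (forall n, \sum_(0 <= k < n) `|a k| <= B) ->
  rho < 1 -> (forall k, `|a k| <= rho) ->
  limn (fun n => \prod_(0 <= k < n) (1 + a k) : Cplx R) != 0.
Proof.
move=> aB rho1 arho.
have rho0 : 0 < 1 - rho by rewrite subr_gt0.
have h k : 1 - rho <= `|1 + a k|.
  have := ler_normB (1 + a k) (a k); rewrite addrK normr1 => h.
  by rewrite lerBlDr; apply: (le_trans h); rewrite lerD2l.
have h0 k : 1 + a k != 0.
  by rewrite -normr_gt0 (lt_le_trans rho0).
have cb : cvgn (fun n => \prod_(0 <= k < n) (1 + (- a k / (1 + a k))) : Cplx R).
  apply: (@cvg_prod _ (B / (1 - rho))) => n.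
  apply: (@le_trans _ _ ((\sum_(0 <= k < n) `|a k|) / (1 - rho))).
    rewrite mulr_suml; apply: ler_sum => k _; rewrite normrM normrN ler_wpM2l //.
    by rewrite normfV lef_pV2 // posrE // normr_gt0.
  by rewrite ler_wpM2r // invr_ge0 ltW.
have ca := cvg_prod aB.
have := cvgM ca cb.
rewrite (_ : _ \* _ = fun=> 1).
  move=> hab.
  have e := cvg_unique (@norm_hausdorff _ _) (cvg_cst (1 : Cplx R)) (hab _).
  apply/eqP => l0.
  by have := oner_neq0 (Cplx R); rewrite e l0 mul0r eqxx.
apply/funext => n /=; rewrite -big_split /= big1 // => k _.
by rewrite mulNr mulrDr mulr1 mulrN mulrCA mulfV // mulr1 addrK.
Qed.

Lemma geometric_bounded (F : numFieldType) (r : F) n : 0 <= r < 1 ->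
  \sum_(0 <= k < n) r ^+ k <= (1 - r)^-1.
Proof.
move=> /andP[r0 r1]; have r1' : 0 < 1 - r by rewrite subr_gt0.
rewrite -[leRHS]mul1r ler_pdivlMr // mulrC big_mkord.
by rewrite -[1 - r]opprB mulNr -subrX1 opprB gerBl exprn_ge0.
Qed.

Variable q : Cplx R.
Hypothesis q1 : `|q| < 1.

Lemma sum_norm_qfactor (a : Cplx R) n : `|a| <= `|q| ->
  \sum_(0 <= k < n) `|a * q ^+ k| <= (1 - `|q|)^-1.
Proof.
move=> aq; apply: le_trans (geometric_bounded n (_ : 0 <= `|q| < 1)); last first.
  by rewrite normr_ge0.
apply: ler_sum => k _; rewrite normrM normrX ler_piMl ?exprn_ge0 //.
by rewrite (le_trans aq) // ltW.
Qed.

Lemma qprod_cvg (a : Cplx R) : `|a| <= `|q| ->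
  cvgn (fun n => \prod_(0 <= k < n) (1 + a * q ^+ k) : Cplx R).
Proof. by move=> aq; apply: cvg_prod => n; exact: sum_norm_qfactor. Qed.

Lemma qprod_neq0 (a : Cplx R) : `|a| <= `|q| ->
  limn (fun n => \prod_(0 <= k < n) (1 + a * q ^+ k) : Cplx R) != 0.
Proof.
move=> aq; apply: lim_prod_neq0 q1 _ => [n|k]; first exact: sum_norm_qfactor.
by apply: le_trans aq; rewrite normrM normrX ler_piMr // exprn_ile1 // ltW.
Qed.

Lemma cvg_norm_expr0 : (fun n => `|q| ^+ n : Cplx R) @ \oo --> (0 : Cplx R).
Proof.
apply: cvg_series_cvg_0; apply: (@bounded_norm_cvg_seriesC _ _ (1 - `|q|)^-1) => n.
under eq_bigr do rewrite ger0_norm ?exprn_ge0 //.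
by apply: geometric_bounded; rewrite normr_ge0.
Qed.

End Products.

Lemma halving_bounded (F : numFieldType) (u : nat -> F) K :
  (forall k, 0 <= u k) -> (forall k, (K <= k)%N -> 2 * u k.+1 <= u k) ->
  exists B, forall n, \sum_(0 <= k < n) u k <= B.
Proof.
move=> u0 hu; exists (\sum_(0 <= k < K) u k + 2 * u K) => n.
(* From [K] on, the partial sum plus twice the next term does not increase. *)
have H m : \sum_(0 <= k < K + m) u k + 2 * u (K + m)%N <=
    \sum_(0 <= k < K) u k + 2 * u K.
  elim: m => [|m IH]; first by rewrite addn0.
  apply: le_trans IH; rewrite addnS big_nat_recr //= -addrA lerD2l.
  by rewrite [leRHS]mulr_natl mulr2n lerD2l hu // leq_addr.
apply: le_trans (H n); apply: ler_wpDr; first by rewrite mulr_ge0.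
rewrite addnC (big_cat_nat (leq0n n) (leq_addr K n)) /= lerDl.
by apply: sumr_ge0.
Qed.

(** * Limits of the bounded generating functions *)

Lemma box_mex_sum_coef (F : comNzRingType) N M K (x : F) :
  all (fun l => weight l < K)%N (box N M) ->
  box_mex_sum N M x = \sum_(0 <= n < K) (box_mex_coef N M n)%:R * x ^+ n.
Proof.
move=> /allP wK; rewrite /box_mex_sum /box_mex_coef.
under [RHS]eq_bigr do rewrite natr_sum mulr_suml.
under [RHS]eq_bigr do rewrite big_seq_cond.
rewrite (exchange_big_dep (fun l => (l \in box N M) && (Mex l <= N)%N)) /=; last first.
  by move=> n l _ /and3P[-> ->].
rewrite big_seq_cond; apply: eq_bigr => l /andP[lB Nl].
rewrite lB Nl /= big_mkord.
by rewrite (big_pred1 (Ordinal (wK _ lB))) //= => n; rewrite eq_sym.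
Qed.

Lemma box_weight_bounded N M : exists K0, forall K, (K0 <= K)%N ->
  all (fun l => weight l < K)%N (box N M).
Proof.
exists (\max_(l <- box N M) (weight l).+1)%N => K hK.
by apply/allP => l lB; apply: leq_trans hK; apply: leq_bigmax_seq.
Qed.

Section BoxLimit.
Variable R : realType.
Implicit Types q : Cplx R.

(** A right-hand term without its infinite product; at [k = 0], where [k.-1] is 0, the factor [k]
    kills it. *)
Definition mex_coef q k : Cplx R := k%:R * 2 ^+ k.-1 * q ^+ 'C(k, 2) * (1 - q ^+ k).
(* [prod1D q n] and [prod1B q n] are (-q;q)_n and (q;q)_n. *)
Definition prod1D q n : Cplx R := \prod_(0 <= k < n) (1 + q * q ^+ k).
Definition prod1B q n : Cplx R := \prod_(0 <= k < n) (1 + (- q) * q ^+ k).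
(** For [|q| < 1], the partial sum of the right-hand series divided by [(-q;q)_oo]. *)
Definition mex_partial q n : Cplx R := \sum_(0 <= k < n) mex_coef q k / prod1D q k.

Lemma prod1DS q n : prod1D q n.+1 = prod1D q n * (1 + q ^+ n.+1).
Proof. by rewrite /prod1D big_nat_recr //= -exprS. Qed.

Lemma prod1BS q n : prod1B q n.+1 = prod1B q n * (1 - q ^+ n.+1).
Proof. by rewrite /prod1B big_nat_recr //= mulNr -exprS. Qed.

Lemma norm_exprS_lt1 q n : `|q| < 1 -> `|q ^+ n.+1| < 1.
Proof. by move=> q1; rewrite normrX exprn_ilt1. Qed.

Lemma expr1B_neq0 q n : `|q| < 1 -> 1 - q ^+ n.+1 != 0.
Proof.
move=> q1; rewrite subr_eq0; apply/eqP => e.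
by have := norm_exprS_lt1 n q1; rewrite -e normr1 ltxx.
Qed.

Lemma expr1D_neq0 q n : `|q| < 1 -> 1 + q ^+ n.+1 != 0.
Proof.
move=> q1; rewrite addr_eq0; apply/eqP => e.
by have := norm_exprS_lt1 n q1; rewrite -normrN -e normr1 ltxx.
Qed.

Lemma prod1D_neq0 q n : `|q| < 1 -> prod1D q n != 0.
Proof.
move=> q1; elim: n => [|n IH]; first by rewrite /prod1D big_geq ?oner_neq0.
by rewrite prod1DS mulf_neq0 ?expr1D_neq0.
Qed.

Lemma prod1B_neq0 q n : `|q| < 1 -> prod1B q n != 0.
Proof.
move=> q1; elim: n => [|n IH]; first by rewrite /prod1B big_geq ?oner_neq0.
by rewrite prod1BS mulf_neq0 ?expr1B_neq0.
Qed.

Lemma expr_cvg0 q : `|q| < 1 -> (fun n => q ^+ n : Cplx R) @ \oo --> (0 : Cplx R).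
Proof.
move=> q1; apply/cvgr0Pnorm_lt => e e0.
have /cvgr0Pnorm_lt/(_ e e0) := cvg_norm_expr0 q1.
by apply: filterS => n; rewrite normrX normr_id normrX.
Qed.

Lemma block_sum_cvg q N : `|q| < 1 ->
  (fun M => block_sum N.+1 M q) @ \oo --> (2 * q ^+ N.+1 / (1 - q ^+ N.+1) : Cplx R).
Proof.
move=> q1; set y := q ^+ N.+1; have y1 : 1 - y != 0 by exact: expr1B_neq0.
have -> : (fun M => block_sum N.+1 M q) = (fun M => 2 * y / (1 - y) * (1 - y ^+ M)).
  apply/funext => M; rewrite /block_sum -/y; under eq_bigr do rewrite exprS.
  rewrite -mulr_sumr big_mkord -(opprB (y ^+ M)) subrX1 -mulNr opprB.
  by rewrite mulrA [RHS]mulrA divfK // mulrA.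
rewrite -[X in _ --> X]mulr1; apply: cvgMr; rewrite -[X in _ --> X]subr0.
by apply: cvgB; [exact: cvg_cst|apply: expr_cvg0; exact: norm_exprS_lt1].
Qed.

(** The limit is the product of [2 q^j / (1 - q^j)] over [1 <= j <= N], whose exponents add up to
    ['C(N.+1, 2)]. *)
Lemma box_full_sum_cvg q N : `|q| < 1 ->
  (fun M => box_full_sum N M q) @ \oo --> (2 ^+ N * q ^+ 'C(N.+1, 2) / prod1B q N : Cplx R).
Proof.
have Mex0 : Mex [::] = 1%N by apply: eq_Mex => // -[].
move=> q1; elim: N => [|N IH].
  rewrite (_ : (fun M => _) = fun=> 1).
    by rewrite /prod1B big_geq // bin_small // !expr0 !mulr1 divr1; exact: cvg_cst.
  by apply/funext => M; rewrite /box_full_sum /= big_cons big_nil /= Mex0 addr0 expr0.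
under eq_fun do rewrite box_full_sumS.
have -> : 2 ^+ N.+1 * q ^+ 'C(N.+2, 2) / prod1B q N.+1 =
    (2 ^+ N * q ^+ 'C(N.+1, 2) / prod1B q N) * (2 * q ^+ N.+1 / (1 - q ^+ N.+1)).
  by rewrite prod1BS binS bin1 addnC exprS exprD invfM; ring.
exact: cvgM IH (@block_sum_cvg q N q1).
Qed.

Lemma box_mex_sum_cvg q N : `|q| < 1 ->
  (fun M => box_mex_sum N M q) @ \oo -->
  (prod1D q N * mex_partial q N.+1 / prod1B q N : Cplx R).
Proof.
have Mex0 : Mex [::] = 1%N by apply: eq_Mex => // -[].
move=> q1; elim: N => [|N IH].
  (* Only the empty list remains, and its Mex 1 exceeds the bound 0. *)
  rewrite (_ : (fun M => _) = fun=> 0).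
    rewrite /mex_partial big_nat1 /mex_coef !mul0r mulr0 mul0r; exact: cvg_cst.
  by apply/funext => M; rewrite /box_mex_sum /= big_cons big_nil /= Mex0.
under eq_fun do rewrite box_mex_sumS.
(* With [y = q^(N+1)], one has [1 + 2 y / (1 - y) = (1 + y) / (1 - y)]; in the new term of
   [mex_partial], the factor [1 - y] cancels against the last factor of [prod1B]. *)
have -> : prod1D q N.+1 * mex_partial q N.+2 / prod1B q N.+1 =
    (prod1D q N * mex_partial q N.+1 / prod1B q N) *
      (1 + 2 * q ^+ N.+1 / (1 - q ^+ N.+1)) +
    N.+1%:R * (2 ^+ N * q ^+ 'C(N.+1, 2) / prod1B q N).
  rewrite {1}/mex_partial big_nat_recr //= -/(mex_partial q N.+1) /mex_coef.
  have := expr1B_neq0 N q1; have := expr1D_neq0 N q1.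
  have := prod1B_neq0 N q1; have := prod1D_neq0 N q1.
  rewrite prod1BS prod1DS /=; move: (q ^+ N.+1) (N.+1%:R) => y m hD hB y1 y2.
  field. by rewrite hD hB y1 y2.
apply: cvgD.
  apply: cvgM; first exact: IH.
  by apply: cvgD; [exact: cvg_cst|exact: block_sum_cvg].
by apply: cvgM; [exact: cvg_cst|exact: box_full_sum_cvg].
Qed.

Lemma qpochhammer_qE q : qpochhammer q q = limn (prod1B q).
Proof. by rewrite /qpochhammer; under eq_fun do under eq_bigr do rewrite -mulNr. Qed.

Lemma prod1D_cvg q : `|q| < 1 -> cvgn (prod1D q).
Proof. by move=> q1; apply: qprod_cvg. Qed.

Lemma prod1B_cvg q : `|q| < 1 -> cvgn (prod1B q).
Proof. by move=> q1; apply: (qprod_cvg q1); rewrite normrN. Qed.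

Lemma lim_prod1D_neq0 q : `|q| < 1 -> limn (prod1D q) != 0.
Proof. by move=> q1; apply: qprod_neq0. Qed.

Lemma lim_prod1B_neq0 q : `|q| < 1 -> limn (prod1B q) != 0.
Proof. by move=> q1; apply: (qprod_neq0 q1); rewrite normrN. Qed.

(** Limit in [n] of [(-q;q)_(n+k) = (-q;q)_k (-q^(k+1);q)_n]. *)
Lemma qpochhammer_shiftE q k : `|q| < 1 ->
  qpochhammer (- q ^+ k.+1) q = limn (prod1D q) / prod1D q k.
Proof.
move=> q1; have k0 := prod1D_neq0 k q1.
rewrite /qpochhammer (_ : (fun n => _) = (fun n => prod1D q (n + k) / prod1D q k)).
  apply: cvg_lim; first exact: norm_hausdorff.
  by apply: cvgMl; rewrite (cvg_shiftn k); exact: prod1D_cvg.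
apply/funext => n; have -> : prod1D q (n + k) =
    prod1D q k * \prod_(0 <= i < n) (1 + q * q ^+ (i + k)).
  rewrite {1}/prod1D (big_cat_nat (leq0n k) (leq_addl n k)) /=.
  by rewrite -{2}[k]add0n big_addn addnK.
rewrite mulrAC mulfV // mul1r; apply: eq_bigr => i _.
by rewrite mulNr opprK exprS -mulrA -exprD addnC.
Qed.

(** Bounding [1 - r^k] and [1 / (-r;r)_k] by 1 leaves the terms [u k], whose quadratic exponent
    makes each eventually at most half the previous one. *)
Lemma series_mex_bounded q : `|q| < 1 ->
  exists B : Cplx R, forall N, `|prod1D `|q| N * mex_partial `|q| N.+1| <= B.
Proof.
move=> q1; set r := `|q|; have r0 : 0 <= r by exact: normr_ge0.
have r1 : `|r| < 1 by rewrite normr_id.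
pose u k : Cplx R := k%:R * 2 ^+ k.-1 * r ^+ 'C(k, 2).
have u0 k : 0 <= u k by rewrite !mulr_ge0 ?exprn_ge0 ?ler0n.
(* For [k >= 1], [2 * u k.+1 = 4 (k+1) r^k (2^(k-1) r^C(k,2))] and [k + 1 <= 2 k], which gives the
   constant 8. *)
have [K hK] : exists K, forall k, (K <= k)%N -> 8 * r ^+ k <= 1.
  have /cvgr0Pnorm_le/(_ 8^-1) := expr_cvg0 r1.
  rewrite invr_gt0 ltr0n => /(_ isT) [K _ hK]; exists K => k /hK /=.
  by rewrite ger0_norm ?exprn_ge0 // -[_^-1]mul1r ler_pdivlMr // mulrC.
have [B hB] : exists B, forall n, \sum_(0 <= k < n) u k <= B.
  apply: (@halving_bounded _ _ (maxn K 1)) => // k; rewrite geq_max => /andP[Kk k1].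
  have -> : 2 * u k.+1 = (4 * k.+1%:R * r ^+ k) * (2 ^+ k.-1 * r ^+ 'C(k, 2)).
    rewrite /u binS bin1 addnC exprD /=; case: k k1 {Kk} => // k _.
    by rewrite [in 2 ^+ _]exprS /=; ring.
  rewrite /u -[leRHS]mulrA ler_wpM2r ?mulr_ge0 ?exprn_ge0 //.
  apply: (@le_trans _ _ (8 * r ^+ k * k%:R)); last by rewrite ler_piMl ?hK.
  rewrite [leRHS]mulrAC ler_wpM2r ?exprn_ge0 //.
  rewrite -!natrM ler_nat; case: k k1 {Kk} => // k _.
  by rewrite (mulnDl 4 4) mulnS leq_add // leq_pmulr.
have [C hC] := @prod_norm_bounded _ (fun k => r * r ^+ k) _
  (fun n => sum_norm_qfactor r1 n (lexx _)).
have hC' n : prod1D r n <= C.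
  apply: le_trans (hC n); rewrite le_eqVlt; apply/orP; left; apply/eqP.
  by apply: eq_bigr => k _; rewrite ger0_norm // mulr_ge0 ?exprn_ge0.
have D1 n : 1 <= prod1D r n.
  by rewrite /prod1D; elim/big_ind: _ => // [x y x1 y1|k _];
    [rewrite mulr_ege1|rewrite lerDl mulr_ge0 ?exprn_ge0].
have D0 n : 0 <= prod1D r n by apply: le_trans (D1 n).
have P0 N : 0 <= mex_partial r N.
  apply: sumr_ge0 => k _; apply: divr_ge0 => //.
  by rewrite /mex_coef -/(u k) mulr_ge0 // subr_ge0 exprn_ile1 // ltW.
exists (C * B) => N; rewrite ger0_norm ?mulr_ge0 //; apply: ler_pM => //.
apply: le_trans (hB N.+1); apply: ler_sum => k _.
rewrite ler_pdivrMr; last exact: lt_le_trans (D1 k).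
apply: (@le_trans _ _ (u k)); last by rewrite ler_peMr.
by rewrite /mex_coef -/(u k) ler_piMr // gerBl exprn_ge0.
Qed.

End BoxLimit.

(** * Bounded generating polynomials against partial sums of the series *)

Section Compare.
Variables (F : numDomainType) (N M K : nat).
Hypotheses (NM : (N <= M)%N) (NK : (N <= K)%N)
  (wK : all (fun l => weight l < K)%N (box N M)).

(** Coefficients below degree [N] are exact; [K] is any cutoff above all weights in the box. *)
Lemma box_mex_sum_split (x : F) : box_mex_sum N M x =
  \sum_(0 <= n < N) (sigma_Mex n)%:R * x ^+ n +
  \sum_(N <= n < K) (box_mex_coef N M n)%:R * x ^+ n.
Proof.
rewrite (box_mex_sum_coef _ wK) (big_cat_nat (leq0n N) NK) /=; congr (_ + _).
apply: eq_big_nat => n /andP[_ nN].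
by rewrite box_mex_coefE // (leq_trans (ltnW nN)).
Qed.

Lemma sigma_Mex_sum_le (x : F) : 0 <= x ->
  \sum_(0 <= n < N) (sigma_Mex n)%:R * x ^+ n <= box_mex_sum N M x.
Proof.
move=> x0; rewrite box_mex_sum_split lerDl.
by apply: sumr_ge0 => n _; rewrite mulr_ge0 ?exprn_ge0.
Qed.

Lemma box_mex_sum_approx (x : F) :
  `|box_mex_sum N M x - \sum_(0 <= n < N) (sigma_Mex n)%:R * x ^+ n| <=
  \sum_(N <= n < K) (sigma_Mex n)%:R * `|x| ^+ n.
Proof.
rewrite box_mex_sum_split addrAC subrr add0r; apply: (le_trans (ler_norm_sum _ _ _)).
apply: ler_sum => n _; rewrite normrM normrX normr_nat.
by rewrite ler_wpM2r ?exprn_ge0 // ler_nat box_mex_coef_le.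
Qed.

End Compare.

(** * Convergence of the series of [sigma_Mex] *)

Section SigmaMexSeries.
Variables (R : realType) (q : Cplx R).
Hypothesis q1 : `|q| < 1.

Let sigma_term (x : Cplx R) n : Cplx R := (sigma_Mex n)%:R * x ^+ n.

Let box_limit (x : Cplx R) N : Cplx R :=
  prod1D x N * mex_partial x N.+1 / prod1B x N.

Lemma box_limit_near (x e : Cplx R) N M0 : `|x| < 1 -> 0 < e ->
  exists2 M, (M0 <= M)%N & `|box_limit x N - box_mex_sum N M x| < e.
Proof.
move=> x1 e0; have /cvgrPdist_lt/(_ e e0)[M1 _ hM] := @box_mex_sum_cvg _ x N x1.
exists (maxn M0 M1); first exact: leq_maxl.
by apply: hM => /=; exact: leq_maxr.
Qed.

(** At the nonnegative point [|q|], partial sums lie below [box_mex_sum], which is close to the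
    bounded [box_limit] for a suitable [M]. *)
Lemma sigma_norm_bounded :
  exists B : Cplx R, forall n, \sum_(0 <= k < n) `|sigma_term q k| <= B.
Proof.
have r1 := q1; rewrite -normr_id in r1.
have [B hB] := series_mex_bounded q1.
have [C hC] : exists C : Cplx R, forall N, `|(prod1B `|q| N)^-1| <= C.
  have : cvgn (fun N => (prod1B `|q| N)^-1 : Cplx R).
    by apply: is_cvgV; [exact: lim_prod1B_neq0|exact: prod1B_cvg].
  move=> /cvg_seq_bounded[C [C_real hC]].
  by exists (C + 1) => N; apply: hC; rewrite ?ltrDl.
(* [B * C] bounds [box_limit]; the 1 is the error of replacing it by [box_mex_sum n M]. *)
exists (B * C + 1) => n.
have [M nM hM] := @box_limit_near `|q| 1 n n r1 ltr01.
have [K0 hK] := box_weight_bounded n M.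
apply: (@le_trans _ _ (box_mex_sum n M `|q|)).
  under eq_bigr do rewrite normrM normrX normr_nat.
  exact: (sigma_Mex_sum_le nM (leq_maxl n K0) (hK _ (leq_maxr _ _)) (normr_ge0 _)).
have b0 : 0 <= box_mex_sum n M `|q|.
  by apply: sumr_ge0 => l _; rewrite mulr_ge0 ?exprn_ge0.
rewrite -[leLHS]ger0_norm // -[X in `|X|](subrK (box_limit `|q| n)) addrC.
apply: (le_trans (ler_normD _ _)); apply: lerD; last by rewrite distrC ltW.
by rewrite /box_limit normrM; apply: ler_pM.
Qed.

Lemma sigma_tail_small (e : Cplx R) : 0 < e -> exists N0, forall N K,
  (N0 <= N)%N -> (N <= K)%N -> \sum_(N <= k < K) (sigma_Mex k)%:R * `|q| ^+ k < e.
Proof.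
move=> e0; have [B hB] := sigma_norm_bounded.
have : cvgn (series (fun k => `|sigma_term q k| : Cplx R)).
  apply: (@bounded_norm_cvg_seriesC _ _ B) => n.
  by under eq_bigr do rewrite normr_id.
move=> /cvgrPdist_lt/(_ (e / 2)) [|N0 _ hN]; first by rewrite divr_gt0.
exists N0 => N K N0N NK.
have hS := hN _ N0N; have hK := hN _ (leq_trans N0N NK).
have -> : \sum_(N <= k < K) (sigma_Mex k)%:R * `|q| ^+ k =
    `|series (fun k => `|sigma_term q k| : Cplx R) K -
      series (fun k => `|sigma_term q k| : Cplx R) N|.
  rewrite sub_series_geq // [RHS]ger0_norm ?sumr_ge0 //.
  by apply: eq_bigr => k _; rewrite normrM normrX normr_nat.
rewrite (splitr e); apply: le_lt_trans (ltrD hK hS).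
by rewrite [X in _ <= X + _]distrC; apply: ler_distD.
Qed.

Lemma sigma_series_cvg : cvgn (series (sigma_term q)).
Proof.
by have [B hB] := sigma_norm_bounded; exact: bounded_norm_cvg_seriesC hB.
Qed.

(** The error splits into [e / 2] from the limit to the partial sum, [e / 4] from there to
    [box_mex_sum] by the tail, and [e / 4] from there to [box_limit]. *)
Lemma box_limit_cvg : box_limit q @ \oo --> limn (series (sigma_term q)).
Proof.
apply/cvgrPdist_lt => e e0.
have e2 : 0 < e / 2 by rewrite divr_gt0.
have e4 : 0 < e / 2 / 2 by rewrite divr_gt0.
have /cvgrPdist_lt/(_ _ e2)[N1 _ hN1] := sigma_series_cvg.
have [N2 hN2] := sigma_tail_small e4.
exists (maxn N1 N2) => // N /=; rewrite geq_max => /andP[N1N N2N].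
(* [M] is chosen after [N]; the tail estimate holds for every [M >= N]. *)
have [M NM hM] := @box_limit_near q _ N N q1 e4.
have [K0 hK] := box_weight_bounded N M.
rewrite (splitr e); apply: le_lt_trans (ler_distD (series (sigma_term q) N) _ _) _.
apply: ltrD; first exact: hN1.
rewrite (splitr (e / 2)); apply: le_lt_trans (ler_distD (box_mex_sum N M q) _ _) _.
apply: ltrD; last by rewrite distrC.
rewrite distrC; apply: le_lt_trans (hN2 N (maxn N K0) N2N (leq_maxl _ _)).
exact: (box_mex_sum_approx NM (leq_maxl N K0) (hK _ (leq_maxr _ _))).
Qed.

End SigmaMexSeries.

Theorem theorem1p4 (R : realType) (q : Cplx R) (hq : `|q| < 1) :
  let lhs : nat -> Cplx R := fun n => (sigma_Mex n)%:R * q ^+ n in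
  let rhs : nat -> Cplx R := fun k =>
    k%:R * 2 ^+ k.-1 * q ^+ 'C(k, 2) * qpochhammer (- q ^+ k.+1) q *
      (1 - q ^+ k) in
  [/\ cvgn (series lhs),
      cvgn (series rhs) &
      limn (series lhs) = 1 / qpochhammer q q * limn (series rhs)].
Proof.
move=> lhs rhs.
have B0 := lim_prod1B_neq0 hq; have D0 := lim_prod1D_neq0 hq.
have rhsE n : series rhs n = limn (prod1D q) * mex_partial q n.
  rewrite /series /= /mex_partial mulr_sumr; apply: eq_bigr => k _.
  by rewrite /rhs qpochhammer_shiftE // /mex_coef; ring.
have rhs_cvg : series rhs @ \oo --> limn (prod1B q) * limn (series lhs).
  (* The shift matches [box_limit] at [n], which involves [mex_partial q n.+1]. *)
  rewrite -(cvg_shiftS (series rhs)).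
  (* The first quotient tends to 1, [prod1B q n] to [(q;q)_oo], and the last factor is
     [box_limit]. *)
  have -> : (fun n => series rhs n.+1) = (fun n => limn (prod1D q) / prod1D q n *
      (prod1B q n * (prod1D q n * mex_partial q n.+1 / prod1B q n))).
    apply/funext => n; rewrite rhsE.
    by field; rewrite prod1B_neq0 // prod1D_neq0.
  rewrite -[limn (prod1B q) * _]mul1r -[X in X * _](mulfV D0).
  apply: cvgM.
    by apply: cvgM; [exact: cvg_cst|apply: cvgV => //; exact: prod1D_cvg].
  by apply: cvgM; [exact: prod1B_cvg|exact: box_limit_cvg].
split; first exact: sigma_series_cvg.
  by apply/cvg_ex; eexists; exact: rhs_cvg.
rewrite (cvg_lim _ rhs_cvg); last exact: norm_hausdorff.
by rewrite qpochhammer_qE mulrA mul1r mulVf // mul1r.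
Qed.
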